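(* Let $G$ and $H$ be finite groups acting on themselves and on each other. If the mutual actions are fully compatible, then the box-tensor product $G\boxtimes H$ is finite.
   Context: All actions are left actions by automorphisms. $G$ and $H$ act on themselves and on each other through homomorphisms $\rho_G\colon G\to \mathrm{Aut}(G)$, $\rho_H\colon H\to\mathrm{Aut}(H)$, $\sigma_G\colon G\to\mathrm{Aut}(H)$, $\sigma_H\colon H\to \mathrm{Aut}(G)$ (four arbitrary homomorphisms; in particular a group need not act on itself by conjugation). For $a,b\in G\cup H$ (disjoint union), ${}^{a}b$ denotes the result of acting by $a$ on $b$ through the relevant one of these homomorphisms. The mutual actions are fully compatible if ${}^{({}^{a}b)}c={}^{a}\big({}^{b}({}^{a^{-1}}c)\big)$ for all $a,b,c\in G\cup H$. For groups acting fully compatibly, the box-tensor product $G\boxtimes H$ is the group generated by the symbols $g\boxtimes h$ ($g\in G$, $h\in H$) subject to the relations $gg'\boxtimes h=({}^{g}g'\boxtimes {}^{g}h)(g\boxtimes h)$ and $g\boxtimes hh'=(g\boxtimes h)({}^{h}g\boxtimes {}^{h}h')$ for all $g,g'\in G$, $h,h'\in H$. *)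

(* Defs.v *)
From HB Require Import structures.
From mathcomp Require Import all_boot fingroup generic_quotient.
From mathcomp Require Import boolp classical_sets cardinality.

Set Implicit Arguments.
Unset Strict Implicit.
Unset Printing Implicit Defensive.

Local Open Scope group_scope.
Local Open Scope quotient_scope.

(* mathcomp.fingroup.presentation only describes finite groups, so the group  *)
(* < X | u = v for R u v > is built here as a quotient of words by the least  *)
(* congruence containing R and free cancellation.                             *)
Section Presentation.

Variable X : choiceType.

(* The letter (x, false) stands for x and (x, true) for its formal inverse.   *)
Definition word := seq (X * bool).

Definition letter_inv (l : X * bool) : X * bool := (l.1, ~~ l.2).

Definition word_inv (w : word) : word := rev (map letter_inv w).

Variable R : word -> word -> Prop.

Inductive word_eq : word -> word -> Prop :=
| word_eq_refl u : word_eq u u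
| word_eq_sym u v : word_eq u v -> word_eq v u
| word_eq_trans u v w : word_eq u v -> word_eq v w -> word_eq u w
| word_eq_cat u u' v v' :
    word_eq u u' -> word_eq v v' -> word_eq (u ++ v) (u' ++ v')
| word_eq_cancel l : word_eq [:: l; letter_inv l] [::]
| word_eq_rel u v : R u v -> word_eq u v.

Definition word_eqb (u v : word) : bool := `[< word_eq u v >].

Fact word_eqb_refl : reflexive word_eqb.
Proof. by move=> u; apply/asboolP; exact: word_eq_refl. Qed.

Fact word_eqb_sym : symmetric word_eqb.
Proof. by move=> u v; apply/asboolP/asboolP; exact: word_eq_sym. Qed.

Fact word_eqb_trans : transitive word_eqb.
Proof.
by move=> v u w /asboolP uv /asboolP vw; apply/asboolP/(word_eq_trans uv vw).
Qed.

Canonical word_eq_equiv :=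
  EquivRel word_eqb word_eqb_refl word_eqb_sym word_eqb_trans.

Definition presented : Type := {eq_quot word_eq_equiv}.

HB.instance Definition _ := EqQuotient.on presented.
HB.instance Definition _ := Choice.on presented.

Definition wclass (w : word) : presented := \pi_presented w.

Lemma wclassP u v : wclass u = wclass v <-> word_eq u v.
Proof.
split; first by move=> /eqmodP /asboolP.
by move=> uv; apply/eqmodP/asboolP.
Qed.

Lemma wclass_reprK c : wclass (repr c) = c.
Proof. exact: reprK. Qed.

Lemma word_eq_repr w : word_eq (repr (wclass w)) w.
Proof. by apply/wclassP; exact: wclass_reprK. Qed.

Lemma letter_invK : involutive letter_inv.
Proof. by case=> x b; rewrite /letter_inv negbK. Qed.

Lemma word_invK : involutive word_inv.
Proof. by move=> w; rewrite /word_inv map_rev revK (mapK letter_invK). Qed.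

Lemma word_inv_cat u v : word_inv (u ++ v) = word_inv v ++ word_inv u.
Proof. by rewrite /word_inv map_cat rev_cat. Qed.

Lemma word_eq_catV w : word_eq (w ++ word_inv w) [::].
Proof.
elim: w => [|l w IHw]; first exact: word_eq_refl.
rewrite /word_inv map_cons rev_cons -cats1 -/(word_inv w) -cat1s -catA.
apply: word_eq_trans (word_eq_cancel l).
rewrite -[[:: l; _]]/([:: l] ++ [:: letter_inv l]).
apply: word_eq_cat; first exact: word_eq_refl.
rewrite catA -[X in word_eq _ X]cat0s.
by apply: word_eq_cat => //; exact: word_eq_refl.
Qed.

Lemma word_eq_Vcat w : word_eq (word_inv w ++ w) [::].
Proof. by rewrite -[X in _ ++ X]word_invK; exact: word_eq_catV. Qed.

Definition pres_one : presented := wclass [::].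
Definition pres_mul (a b : presented) : presented := wclass (repr a ++ repr b).
Definition pres_inv (a : presented) : presented := wclass (word_inv (repr a)).

Lemma pres_mulE u v : pres_mul (wclass u) (wclass v) = wclass (u ++ v).
Proof. by apply/wclassP; apply: word_eq_cat; exact: word_eq_repr. Qed.

Fact pres_mulA : associative pres_mul.
Proof.
move=> a b c; rewrite -[a]wclass_reprK -[b]wclass_reprK -[c]wclass_reprK.
by rewrite !pres_mulE catA.
Qed.

Fact pres_mul1g : left_id pres_one pres_mul.
Proof. by move=> a; rewrite -[a]wclass_reprK pres_mulE. Qed.

Fact pres_mulg1 : right_id pres_one pres_mul.
Proof. by move=> a; rewrite -[a]wclass_reprK pres_mulE cats0. Qed.

Fact pres_mulVg : left_inverse pres_one pres_inv pres_mul.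
Proof.
move=> a; rewrite -[X in pres_mul _ X]wclass_reprK pres_mulE.
by apply/wclassP; exact: word_eq_Vcat.
Qed.

Fact pres_mulgV : right_inverse pres_one pres_inv pres_mul.
Proof.
move=> a; rewrite -[X in pres_mul X _]wclass_reprK pres_mulE.
by apply/wclassP; exact: word_eq_catV.
Qed.

HB.instance Definition _ := isGroup.Build presented
  pres_mulA pres_mul1g pres_mulg1 pres_mulVg pres_mulgV.

Definition pres_gen (x : X) : presented := wclass [:: (x, false)].

Lemma wclass_cat u v : wclass (u ++ v) = wclass u * wclass v.
Proof. by rewrite -pres_mulE. Qed.

Lemma wclass_nil : wclass [::] = 1.
Proof. by []. Qed.

Lemma wclass_letter l :
  wclass [:: l] = if l.2 then (pres_gen l.1)^-1 else pres_gen l.1.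
Proof.
case: l => x [] //=; apply: (mulgI (pres_gen x)).
rewrite mulgV -wclass_cat -wclass_nil; apply/wclassP.
exact: (word_eq_cancel (x, false)).
Qed.

Section Universal.

Variables (K : groupType) (phi : X -> K).

Definition letter_eval (l : X * bool) : K :=
  if l.2 then (phi l.1)^-1 else phi l.1.

Definition word_eval (w : word) : K := foldr (fun l k => letter_eval l * k) 1 w.

Lemma word_eval_cat u v : word_eval (u ++ v) = word_eval u * word_eval v.
Proof. by elim: u => [|l u IHu] /=; rewrite ?mul1g // IHu mulgA. Qed.

Lemma presented_universal :
  (forall u v, R u v -> word_eval u = word_eval v) ->
  exists! f : presented -> K,
    {morph f : a b / a * b} /\ forall x, f (pres_gen x) = phi x.
Proof.
move=> phiR; have evalE u v : word_eq u v -> word_eval u = word_eval v.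
  elim=> {u v} // [u v w _ -> //|u u' v v' _ eu _ ev|[x b]].
    by rewrite !word_eval_cat eu ev.
  by case: b; rewrite /= /letter_eval /= mulg1 ?mulgV ?mulVg.
exists (fun a => word_eval (repr a)); split; first split.
- move=> a b; rewrite -word_eval_cat; apply: evalE.
  by rewrite -[a in a * _]wclass_reprK -[b in _ * b]wclass_reprK -wclass_cat;
     exact: word_eq_repr.
- by move=> x; rewrite (evalE _ _ (word_eq_repr _)) /= mulg1.
move=> f [fM fX]; apply/funext => a; rewrite -[in RHS](wclass_reprK a).
have f1 : f 1 = 1 by apply: (mulgI (f 1)); rewrite -fM !mulg1.
have fV b : f b^-1 = (f b)^-1 by apply: (mulgI (f b)); rewrite -fM !mulgV.
elim: (repr a) => [|l w IHw] /=; first by rewrite wclass_nil f1.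
rewrite IHw -cat1s wclass_cat fM; congr (_ * _).
by rewrite wclass_letter /letter_eval; case: l.2; rewrite ?fV fX.
Qed.

End Universal.

End Presentation.

(* A homomorphism A -> Aut(B), as a left action: lact a is an endomorphism    *)
(* of B by lact_morph, and a bijection by lact1 and lactM (lact_bij).         *)
Record left_action (A B : groupType) := LeftAction {
  lact :> A -> B -> B;
  lact1 : forall x, lact 1 x = x;
  lactM : forall a b x, lact (a * b) x = lact a (lact b x);
  lact_morph : forall a, {morph lact a : x y / x * y}
}.

Lemma lact_bij (A B : groupType) (s : left_action A B) a : bijective (s a).
Proof. by exists (s a^-1) => x; rewrite -lactM ?mulVg ?mulgV lact1. Qed.

Section BoxTensor.

Variables (G H : groupType).
Variables (rhoG : left_action G G) (rhoH : left_action H H).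
Variables (sigmaG : left_action G H) (sigmaH : left_action H G).

Definition union_act (a b : G + H) : G + H :=
  match a, b with
  | inl g, inl x => inl (rhoG g x)
  | inl g, inr y => inr (sigmaG g y)
  | inr h, inl x => inl (sigmaH h x)
  | inr h, inr y => inr (rhoH h y)
  end.

Definition union_inv (a : G + H) : G + H :=
  match a with inl g => inl g^-1 | inr h => inr h^-1 end.

Definition fully_compatible : Prop :=
  forall a b c : G + H,
    union_act (union_act a b) c
    = union_act a (union_act b (union_act (union_inv a) c)).

Definition box_letter (g : G) (h : H) : (G * H) * bool := ((g, h), false).

Inductive box_rel : word (G * H)%type -> word (G * H)%type -> Prop :=
| box_rel_l g g' h :
    box_rel [:: box_letter (g * g') h]
            [:: box_letter (rhoG g g') (sigmaG g h); box_letter g h]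
| box_rel_r g h h' :
    box_rel [:: box_letter g (h * h')]
            [:: box_letter g h; box_letter (sigmaH h g) (rhoH h h')].

Definition box_tensor : groupType := presented box_rel.

Definition box (g : G) (h : H) : box_tensor := pres_gen box_rel (g, h).

Lemma boxMl g g' h :
  box (g * g') h = box (rhoG g g') (sigmaG g h) * box g h.
Proof.
rewrite /box /pres_gen -wclass_cat; apply/wclassP/word_eq_rel.
exact: box_rel_l.
Qed.

Lemma boxMr g h h' :
  box g (h * h') = box g h * box (sigmaH h g) (rhoH h h').
Proof.
rewrite /box /pres_gen -wclass_cat; apply/wclassP/word_eq_rel.
exact: box_rel_r.
Qed.

Lemma box_tensor_universal (K : groupType) (phi : G -> H -> K) :
  (forall g g' h,
     phi (g * g') h = phi (rhoG g g') (sigmaG g h) * phi g h) ->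
  (forall g h h',
     phi g (h * h') = phi g h * phi (sigmaH h g) (rhoH h h')) ->
  exists! f : box_tensor -> K,
    {morph f : a b / a * b} /\ forall g h, f (box g h) = phi g h.
Proof.
move=> phiMl phiMr.
have [|f [[fM fX] fU]] :=
  @presented_universal _ box_rel K (fun p => phi p.1 p.2).
  by move=> _ _ [g g' h|g h h']; rewrite /= /letter_eval /= !mulg1.
exists f; split; first by split=> // g h; rewrite fX.
by move=> f' [f'M f'X]; apply: fU; split=> // -[g h]; exact: f'X.
Qed.

End BoxTensor.

(* Main.v *)
(* Expanding (gg') box (hh') in two ways shows that conjugation by g box h    *)
(* acts on T := G box H as the commutator of the actions of g and h. Hence T  *)
(* permutes its finite generating set {g box h} by conjugation, through a     *)
(* homomorphism lam to a finite group whose kernel is central. Averaging the  *)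
(* defining relations over G and then over H shows that f (g box h) has order *)
(* dividing |G||H| for every homomorphism f to an abelian group. Taking for f *)
(* the transfer to ker lam, which is a power map on ker lam, each g box h has *)
(* finite order in T, and Dietzmann's lemma concludes.                        *)

From HB Require Import structures.
Require Import Defs.
From mathcomp Require Import all_boot fingroup perm ssralg commutator cyclic.
From mathcomp Require Import generic_quotient.
From mathcomp Require Import boolp classical_sets cardinality.

Set Implicit Arguments.
Unset Strict Implicit.
Unset Printing Implicit Defensive.

Import GRing.Theory.

Local Open Scope group_scope.

(** Torsion is directly visible only in abelian images of T ([box_tensor_abelian_torsion]). Full
    compatibility makes T central-by-finite ([box_exchange], [pair_perm_commg_morph]), so
    [transfer_central_ker] carries this torsion back to the generators; these are finite in number
    and permuted by conjugation, so [dietzmann] applies. *)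

Section CentralKernel.

Variables (T P : groupType) (lam : T -> P).
Hypothesis lamM : {morph lam : a b / a * b}.
Hypothesis lamC : forall z t, lam z = 1 -> z * t = t * z.

Lemma morph1 : lam 1 = 1.
Proof. by apply: (mulgI (lam 1)); rewrite -lamM !mulg1. Qed.

Lemma morphV t : lam t^-1 = (lam t)^-1.
Proof. by apply: (mulgI (lam t)); rewrite -lamM !mulgV morph1. Qed.

Lemma morphX t n : lam (t ^+ n) = lam t ^+ n.
Proof. by elim: n => [|n IHn]; rewrite ?morph1 // !expgS lamM IHn. Qed.

(* The proofs that lam is a morphism with central kernel are parameters of    *)
(* the type so that its zmodType instance can be inferred.                    *)
Definition central_ker of {morph lam : a b / a * b} &
  (forall z t, lam z = 1 -> z * t = t * z) := {t : T | lam t == 1}.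

Local Notation K := (central_ker lamM lamC).

HB.instance Definition _ := Choice.on K.

Definition in_ker t (lt1 : lam t = 1) : K := exist _ t (introT eqP lt1).

Lemma val_kerP (z : K) : lam (val z) = 1.
Proof. by apply/eqP; exact: (valP z). Qed.

Definition ker_zero : K := in_ker morph1.

Fact ker_opp_subproof (z : K) : lam (val z)^-1 = 1.
Proof. by rewrite morphV val_kerP invg1. Qed.

Definition ker_opp (z : K) : K := in_ker (ker_opp_subproof z).

Fact ker_add_subproof (y z : K) : lam (val y * val z) = 1.
Proof. by rewrite lamM !val_kerP mulg1. Qed.

Definition ker_add (y z : K) : K := in_ker (ker_add_subproof y z).

Fact ker_addA : associative ker_add.
Proof. by move=> x y z; apply: val_inj; exact: mulgA. Qed.

Fact ker_addC : commutative ker_add.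
Proof. by move=> x y; apply: val_inj; apply: lamC; exact: val_kerP. Qed.

Fact ker_add0 : left_id ker_zero ker_add.
Proof. by move=> x; apply: val_inj; exact: mul1g. Qed.

Fact ker_addN : left_inverse ker_zero ker_opp ker_add.
Proof. by move=> x; apply: val_inj; exact: mulVg. Qed.

HB.instance Definition _ :=
  GRing.isZmodule.Build K ker_addA ker_addC ker_add0 ker_addN.

Lemma val_kerD (y z : K) : val (y + z)%R = val y * val z.
Proof. by []. Qed.

Lemma val_kerMn (z : K) n : val (z *+ n)%R = val z ^+ n.
Proof. by elim: n => // n IHn; rewrite mulrS expgS val_kerD IHn. Qed.

End CentralKernel.

(* The transfer to a central subgroup Z of finite index n is a homomorphism   *)
(* whose restriction to Z is z |-> z ^+ n.                                    *)
Lemma transfer_central_ker (T : groupType) (P : finGroupType) (lam : T -> P) :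
    {morph lam : a b / a * b} ->
    (forall z t, lam z = 1 -> z * t = t * z) ->
  exists (V : zmodType) (f : T -> V),
    {morph f : a b / a * b >-> (a + b)%R} /\
    exists2 k, 0 < k & forall t n, (f t *+ n = 0)%R -> t ^+ (k * n) = 1.
Proof.
(* [Q] is the image of [lam]; its points index the cosets of the kernel. *)
move=> lamM lamC; pose Q q := `[< exists t, lam t = q >].
have QM t q : Q (lam t * q) = Q q.
  apply/asboolP/asboolP => -[u lamu]; last by exists (t * u); rewrite lamM lamu.
  by exists (t^-1 * u); rewrite lamM lamu (morphV lamM) mulKg.
have Q1 : Q 1 by apply/asboolP; exists 1; exact: morph1.
have /choice [s sP] q : exists t, Q q -> lam t = q.
  by have [/asboolP[t <-]|_] := boolP (Q q); [exists t | exists 1].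
have tauP t (q : {q | Q q}) :
  lam ((s (lam t * val q))^-1 * (t * s (val q))) = 1.
  by rewrite !lamM (morphV lamM) !sP ?QM ?(valP q) // mulVg.
pose tau t (q : {q | Q q}) := in_ker lamM lamC (tauP t q).
have shiftP t (q : {q | Q q}) : Q (lam t * val q) by rewrite QM (valP q).
pose shift t (q : {q | Q q}) : {q | Q q} := Sub (lam t * val q) (shiftP t q).
have shift_inj t : injective (shift t).
  by move=> q r /(congr1 val) /mulgI /val_inj.
have tauM t u q : tau (t * u) q = (tau t (shift u q) + tau u q)%R.
  by apply: val_inj; rewrite /= lamM !mulgA mulgK.
pose f t : central_ker lamM lamC := (\sum_q tau t q)%R.
have fM : {morph f : a b / a * b >-> (a + b)%R}.
  move=> t u; rewrite /f (eq_bigr _ (fun q _ => tauM t u q)) big_split /=.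
  by rewrite [in RHS](reindex_inj (shift_inj u)).
exists (central_ker lamM lamC), f; split=> //.
(* The power [#|P|] moves [t] into the kernel, where the transfer multiplies by the size of the
   image. *)
exists (#|P| * #|{: {q | Q q}}|)%N.
  by rewrite muln_gt0 -cardsT cardG_gt0; apply/card_gt0P; exists (Sub 1 Q1).
move=> t n ftn; rewrite -mulnA expgnA; set z := t ^+ #|P|.
have lamz : lam z = 1 by rewrite (morphX lamM) -cardsT expg_cardG ?inE.
have fz : f z = (in_ker lamM lamC lamz *+ #|{: {q | Q q}}|)%R.
  rewrite -sumr_const; apply: eq_bigr => q _.
  by apply: val_inj; rewrite /= lamz mul1g lamC // mulKg.
have f1 : f 1 = 0%R by apply: (addrI (f 1)); rewrite -fM mulg1 addr0.
have fX m : f (t ^+ m) = (f t *+ m)%R.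
  by elim: m => [|m IHm]; rewrite ?f1 // expgS mulrS fM IHm.
have : (f z *+ n)%R = 0%R by rewrite fX mulrnAC ftn mul0rn.
by rewrite fz -mulrnA => /(congr1 val); rewrite val_kerMn.
Qed.

(* Dietzmann's lemma: a long word contains some x i at least m times; these   *)
(* occurrences can be moved to the front by conjugating the other letters,    *)
(* where they cancel.                                                         *)
Section Dietzmann.

Variables (T : groupType) (I : finType) (x : I -> T) (m : nat).
Hypothesis xJ : forall i j, exists k, x i ^ x j = x k.
Hypothesis m_gt0 : 0 < m.
Hypothesis xm : forall i, x i ^+ m = 1.

Local Notation eval w := (\prod_(i <- w) x i).

Lemma conjugate_expg i j n : exists k, x i ^ (x j ^+ n) = x k.
Proof.
elim: n => [|n [k IHn]]; first by exists i; rewrite conjg1.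
by have [l kl] := xJ k j; exists l; rewrite expgSr conjgM IHn kl.
Qed.

Lemma collect_letter i n (w : seq I) : n <= count_mem i w ->
  exists2 w', size w = n + size w' & eval w = x i ^+ n * eval w'.
Proof.
elim: w n => [|j w IHw] n /=.
  by rewrite leqn0 => /eqP->; exists [::] => //; rewrite mul1g.
case: eqVneq => [-> | _]; last first.
  move=> /IHw[w' sw ew]; have [k jk] := conjugate_expg j i n.
  exists (k :: w'); first by rewrite /= sw addnS.
  by rewrite !big_cons ew mulgA (conjgC (x j)) jk -mulgA.
case: n => [_|n]; first by exists (i :: w) => //; rewrite mul1g.
rewrite add1n ltnS => /IHw[w' sw ew]; exists w'; first by rewrite sw.
by rewrite big_cons ew expgS mulgA.
Qed.

Lemma short_word (w : seq I) :
  exists2 w' : seq I, size w' <= #|I| * m & eval w' = eval w.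
Proof.
have [n] := ubnP (size w); elim: n w => // n IHn w /ltnSE wn.
have [|w_long] := leqP (size w) (#|I| * m); first by exists w.
have [i i_often] : exists i, m <= count_mem i w.
  (* Pigeonhole: if every letter occurred fewer than [m] times, [w] would have length at most
     [#|I| * m]. *)
  apply/existsP; apply: contraLR w_long => /existsPn rare; rewrite -leqNgt.
  rewrite -sum1_size (eq_bigr (fun i => \sum_(j : I | j == i) 1)%N); last first.
    by move=> i _; rewrite big_pred1_eq.
  rewrite (exchange_big_dep xpredT) //= -sum_nat_const; apply: leq_sum => i _.
  rewrite sum1_count ltnW // ltnNge (eq_count (eq_sym i)); exact: rare.
have [w' sw ->] := collect_letter i_often; rewrite xm mul1g.
apply: IHn; rewrite -(ltn_add2l m) -sw; apply: leq_ltn_trans wn _.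
by rewrite -add1n leq_add2r.
Qed.

Lemma generator_inv i : (x i)^-1 = eval (nseq m.-1 i).
Proof.
rewrite big_nseq iter_mulg_1; apply: mulg1_eq.
by rewrite -expgS prednK.
Qed.

Lemma dietzmann :
    (forall t, exists w : seq (I * bool),
       t = \prod_(l <- w) (if l.2 then (x l.1)^-1 else x l.1)) ->
  finite_set [set: T]%classic.
Proof.
move=> x_gen; pose f (w : (#|I| * m).-bseq I) := eval w.
apply: (sub_finite_set _ (finite_image f (@finite_finset _ setT))) => t _.
have [w ->] : exists w : seq I, t = eval w.
  have [w ->] := x_gen t; elim: w => [|[i b] w [w' IHw]].
    by exists [::]; rewrite !big_nil.
  exists ((if b then nseq m.-1 i else [:: i]) ++ w').
  by rewrite big_cons big_cat IHw /=; case: b; rewrite ?generator_inv ?big_seq1.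
by have [w' sw' <-] := short_word w; exists (Bseq sw').
Qed.

End Dietzmann.

Lemma lact_inj (A B : groupType) (s : left_action A B) a : injective (s a).
Proof. exact: bij_inj (lact_bij s a). Qed.

Arguments lact_inj {A B} s a.

Section BoxTensorFinite.

Variables (G H : finGroupType).
Variables (rhoG : left_action G G) (rhoH : left_action H H).
Variables (sigmaG : left_action G H) (sigmaH : left_action H G).

Local Notation T := (box_tensor rhoG rhoH sigmaG sigmaH).
Local Notation bx := (fun p : G * H => box rhoG rhoH sigmaG sigmaH p.1 p.2).

(* After summing over the first argument, then over the second, the actions   *)
(* merely permute the terms.                                                  *)
Lemma box_tensor_abelian_torsion (V : zmodType) (f : T -> V) g h :
  {morph f : a b / a * b >-> (a + b)%R} ->
  (f (box rhoG rhoH sigmaG sigmaH g h) *+ (#|G| * #|H|) = 0)%R.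
Proof.
move=> fM; pose phi g' h' := f (box rhoG rhoH sigmaG sigmaH g' h').
pose S h' := (\sum_g' phi g' h')%R.
(* In the first relation, summed over [g'], the factor [phi g1 h1] is constant, whence the multiple
   [#|G|]. *)
have phiG g1 h1 : (phi g1 h1 *+ #|G| = S h1 - S (sigmaG g1 h1))%R.
  apply/eqP; rewrite eq_sym subr_eq addrC.
  rewrite /S (reindex_inj (mulgI g1)).
  rewrite [X in (_ == X + _)%R](reindex_inj (lact_inj rhoG g1)) /=.
  rewrite -sumr_const -big_split /=; apply/eqP/eq_bigr => g' _.
  by rewrite /phi /= boxMl fM.
have S_torsion h1 : (S h1 *+ #|H| = 0)%R.
  have SM h' : (S (h1 * h')%g = S h1 + S (rhoH h1 h'))%R.
    rewrite /S [X in (_ = _ + X)%R](reindex_inj (lact_inj sigmaH h1)).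
    rewrite -big_split.
    by apply: eq_bigr => g' _; rewrite /phi /= boxMr fM.
  (* Summing [SM] over [h'] puts the total of [S] on both sides, where it cancels. *)
  apply: (addIr (\sum_h' S h')%R).
  rewrite add0r [RHS](reindex_inj (mulgI h1)) /=.
  rewrite (eq_bigr _ (fun h' _ => SM h')) big_split /= sumr_const.
  by rewrite [in LHS](reindex_inj (lact_inj rhoH h1)).
by rewrite mulrnA -/(phi g h) phiG mulrnBl !S_torsion subrr.
Qed.

Lemma box_tensor_generated (t : T) : exists w : seq (G * H * bool),
  t = \prod_(l <- w) (if l.2 then (bx l.1)^-1 else bx l.1).
Proof.
exists (repr t); rewrite -[t in LHS]wclass_reprK.
elim: (repr t) => [|l w IHw]; first by rewrite big_nil wclass_nil.
by rewrite big_cons -IHw -cat1s wclass_cat wclass_letter; case: l => [[]].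
Qed.

Definition pair_act (a : G + H) (p : G * H) : G * H :=
  match a with
  | inl g => (rhoG g p.1, sigmaG g p.2)
  | inr h => (sigmaH h p.1, rhoH h p.2)
  end.

Lemma pair_actK a : cancel (pair_act a) (pair_act (union_inv a)).
Proof. by case: a => a [g h] /=; rewrite -!lactM !mulVg !lact1. Qed.

Definition pair_perm a : {perm G * H} := perm (can_inj (pair_actK a)).

(* The order of the factors is reversed because products in {perm _} are      *)
(* composed from left to right.                                               *)
Lemma pair_permMl g g' :
  pair_perm (inl (g * g')) = pair_perm (inl g') * pair_perm (inl g).
Proof. by apply/permP => p; rewrite permM !permE /= !lactM. Qed.

Lemma pair_permMr h h' :
  pair_perm (inr (h * h')) = pair_perm (inr h') * pair_perm (inr h).
Proof. by apply/permP => p; rewrite permM !permE /= !lactM. Qed.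

Hypothesis compat : fully_compatible rhoG rhoH sigmaG sigmaH.

Lemma pair_act_compat a b p :
  pair_act (union_act rhoG rhoH sigmaG sigmaH a b) p
  = pair_act a (pair_act b (pair_act (union_inv a) p)).
Proof.
case: p => x y; have := compat a b (inr y); have := compat a b (inl x).
by case: a b => [g|h] [g'|h'] [ex] [ey] /=; rewrite ex ey.
Qed.

(** Full compatibility says that acting on an actor is conjugation; with products reversed, this is
    conjugation on the right. *)
Lemma pair_perm_act a b :
  pair_perm (union_act rhoG rhoH sigmaG sigmaH a b)
  = pair_perm b ^ pair_perm a.
Proof.
apply: (mulgI (pair_perm a)); rewrite -conjgC; apply/permP => p.
by rewrite !permM !permE pair_act_compat pair_actK.
Qed.

Lemma box_exchange g h p :
  bx (g, h) * bx (pair_act (inr h) (pair_act (inl g) p))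
  = bx (pair_act (inl g) (pair_act (inr h) p)) * bx (g, h).
Proof.
(* Compatibility simplifies the inner factors of the two expansions below; the outer factors
   coincide and cancel. *)
have [eg eh] : pair_act (inr (sigmaG g h)) (pair_act (inl g) p)
             = pair_act (inl g) (pair_act (inr h) p) /\
               pair_act (inl (sigmaH h g)) (pair_act (inr h) p)
             = pair_act (inr h) (pair_act (inl g) p).
  split; first by rewrite (pair_act_compat (inl g) (inr h)) pair_actK.
  by rewrite (pair_act_compat (inr h) (inl g)) pair_actK.
rewrite -{}eg -{}eh; case: p => g' h' /=.
(* Expand (gg') box (hh') in two ways. *)
have := boxMr rhoG rhoH sigmaG sigmaH (g * g') h h'.
rewrite {1}boxMl !lact_morph boxMr (boxMr _ _ _ _ g) (boxMl _ _ _ _ _ _ h).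
by rewrite boxMl -!mulgA => /mulgI; rewrite !mulgA => /mulIg.
Qed.

(** Once conjugation is read as the action, the commutator identities for products become the two
    defining relations. *)
Lemma pair_perm_commg_morph : exists2 lam : T -> {perm G * H},
  {morph lam : a b / a * b} &
  forall g h, lam (bx (g, h)) = [~ pair_perm (inl g), pair_perm (inr h)].
Proof.
have [g g' h|g h h'|lam [[lamM lamE] _]] := @box_tensor_universal G H
  rhoG rhoH sigmaG sigmaH {perm G * H}
  (fun g h => [~ pair_perm (inl g), pair_perm (inr h)]).
- by rewrite pair_permMl commMgJ conjRg -!pair_perm_act.
- by rewrite pair_permMr commgMJ conjRg -!pair_perm_act.
by exists lam.
Qed.

End BoxTensorFinite.

Theorem theorem4p8 (G H : finGroupType)
    (rhoG : left_action G G) (rhoH : left_action H H)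
    (sigmaG : left_action G H) (sigmaH : left_action H G) :
  fully_compatible rhoG rhoH sigmaG sigmaH ->
  finite_set [set: box_tensor rhoG rhoH sigmaG sigmaH]%classic.
Proof.
pose bx (p : G * H) := box rhoG rhoH sigmaG sigmaH p.1 p.2.
move=> compat; have [lam lamM lamE] := pair_perm_commg_morph compat.
have bxJ t p : bx p ^ t = bx (lam t p).
  have lam1 : lam 1 = 1 := morph1 lamM.
  have bxJgen g h q : bx q ^ bx (g, h) = bx (lam (bx (g, h)) q).
    rewrite lamE; set a := pair_perm _ _ _ _ _; set b := pair_perm _ _ _ _ _.
    (* In terms of [r], the commutator only swaps the order of the two actions, as in
       [box_exchange]. *)
    have [r ->] : exists r, q = (b * a) r.
      by exists ((b * a)^-1 q); rewrite permKV.
    rewrite -permM -commgC !permM /a /b !permE conjgE.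
    by rewrite -(box_exchange compat g h) mulKg.
  have [w ->] := box_tensor_generated t.
  elim: w p => [|[[g h] e] w IHw] p.
    by rewrite big_nil lam1 perm1 conjg1.
  rewrite big_cons conjgM lamM permM -IHw; congr (_ ^ _).
  case: e; rewrite ?(morphV lamM) ?bxJgen //.
  by apply: (canLR (conjgK _)); rewrite bxJgen permKV.
have lamC z t : lam z = 1 -> z * t = t * z.
  (* By [bxJ], an element of the kernel commutes with every generator. *)
  move=> lamz; have zC p : commute z (bx p).
    by apply/commute_sym/commgP/conjg_fixP; rewrite bxJ lamz perm1.
  have [w ->] := box_tensor_generated t.
  by apply: commute_prod => l _; case: l.2; [apply: commuteV|]; exact: zC.
have [V [f [fM [k k_gt0 f_torsion]]]] := transfer_central_ker lamM lamC.
apply: (@dietzmann _ (G * H)%type bx (k * (#|G| * #|H|))).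
- by move=> p q; exists (lam (bx q) p); rewrite bxJ.
- by rewrite !muln_gt0 k_gt0 -!cardsT !cardG_gt0.
- by case=> g h; apply/f_torsion/box_tensor_abelian_torsion.
exact: box_tensor_generated.
Qed.
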